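(* For each infinite cardinal $\kappa$ the Cantor cube $D(2)^{2^\kappa}$ contains a dense submaximal subspace $X$ with $|X|=\Delta(X)=\kappa$.
   Context: $D(2)$ is the discrete two-point space. A space is submaximal if all of its dense subsets are open. $\Delta(X)$ is the minimum cardinality of a nonempty open subset of $X$. *)

(* Defs.v *)
From mathcomp Require Import all_boot.
From mathcomp Require Import all_classical.
From mathcomp Require Import topology.

Set Implicit Arguments.
Unset Strict Implicit.
Unset Printing Implicit Defensive.

Local Open Scope classical_set_scope.
Local Open Scope card_scope.

(* The library topology on bool is the discrete one. *)
Definition cantor_cube (I : Type) : topologicalType :=
  prod_topology (fun _ : I => bool).

Definition submaximal (T : topologicalType) : Prop :=
  forall D : set T, dense D -> open D.

(* Delta(T) = |K|. Cardinals are represented by types up to equipotence, so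
   the minimum is a relation: |K| is attained by some nonempty open set and
   bounds the cardinality of every nonempty open set from below. *)
Definition is_dispersion_character (T : topologicalType) (K : Type) : Prop :=
  (exists U : set T, [/\ open U, U !=set0 & U #= [set: K]]) /\
  (forall U : set T, open U -> U !=set0 -> [set: K] #<= U).

(* Main.v *)
Require Import Defs.
From mathcomp Require Import all_boot.
From mathcomp Require Import all_classical.
From mathcomp Require Import topology.

Local Open Scope classical_set_scope.
Local Open Scope card_scope.

(** A point of the cube with coordinates in [K -> bool] is a set of indices, so
a [K]-indexed family of points is the same as a family [P] of subsets of [K]
indexed by [K -> bool]: the point [k] has coordinate [i] equal to 1 exactly
when [P i k].  A basic open set of the cube traces on [K] a finite Boolean
combination of the sets [P i], called a [pattern] below.  The theorem is thus
a statement about one family [P]: all its patterns have size [|K|]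
(density and dispersion), and every [D] that meets all patterns is a union of
sets [P i] (submaximality); this is [submaximal_family].  Injectivity of the
map from [K] to the cube follows, since the complement of a point meets all
patterns.

The family is obtained by perturbing an independent family [B] all of whose
patterns have size [|K|] ([independent_family]; Hausdorff's construction).
Call a set large if it meets every pattern of [B] in [|K|] points, and take
a maximal family [DD] of large sets that is closed under intersection
([maximal_large_family]).  Indices can be made to run over all pairs [(A, a)]
with [A] a subset and [a] a point of [K] ([surjection_on_pointed_sets]); put
[P i = (B i `&` A) `|` [set a]] when [A] is in [DD], which makes [P i] an open
set inside [A `|` [set a]] that contains [a]; when [A] is not in [DD], replace
it by [setT] here.  So every member of [DD] becomes open.  On some
member of [DD] finitely many sets [P i] coincide with the corresponding [B i],
and therefore patterns of [P] still have size [|K|].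

It remains to see that a set [D] meeting all patterns of [P] lies in [DD].
Otherwise, by maximality, some [A] in [DD] and some pattern of [B] meet [D] in
a set [E] of size less than [|K|].  The complement of such an [E] belongs to
[DD], because deleting fewer than [|K|] points from a set of size [|K|] leaves
[|K|] points ([card_leD_small]).  Remove [E] from [A] and cut down to a member
of [DD] on which [P] and [B] agree for the indices of the pattern: the result
is in [DD], hence open, and it meets the pattern of [P] with these indices in a
nonempty open set that misses [D], a contradiction.

The cardinal arithmetic needed is that [K * K] injects into [K]
([pairing_of_infinite], Hessenberg), which is proved by Zorn's lemma together
with the comparability of cardinals ([card_le_total]). *)

(** * Cardinal comparison *)

(** Comparing cardinals through a relation rather than a function spares the
choice of values, and needs no default element in the target. *)
Lemma card_le_rel {T U : Type} (R : T -> U -> Prop) (A : set T) (B : set U) :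
  (forall x, A x -> exists2 y, B y & R x y) ->
  (forall x x' y, A x -> A x' -> R x y -> R x' y -> x = x') ->
  A #<= B.
Proof.
move=> totR injR.
have /choice[f fP] : forall x : A, exists y : B, R (val x) (val y).
  move=> [x Ax]; have [y By Rxy] := totR x (set_mem Ax).
  by exists (SigSub (mem_set By)).
apply/card_leP/injfunPex; exists f => // x y _ _ fxy.
apply: val_inj; apply: (injR _ _ (val (f x))) => //; last by rewrite fxy.
- exact: set_mem (valP x).
- exact: set_mem (valP y).
Qed.

Lemma card_le_inj {T U : Type} {A : set T} {B : set U} : U -> A #<= B ->
  exists f : T -> U, (forall x, A x -> B (f x)) /\
    (forall x y, A x -> A y -> f x = f y -> x = y).
Proof.
move=> u0 /card_leP[g].
exists (fun x =>
  if pselect (A x) is left Ax then val (g (SigSub (mem_set Ax))) else u0).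
split=> [x Ax|x y Ax Ay].
  by case: pselect => // a; apply: set_mem; exact: valP.
case: pselect => // a; case: pselect => // b.
move=> /val_inj/(inj (mem_set I) (mem_set I)).
by case.
Qed.

(** A maximal partial injection is either total or surjective: otherwise it
could be extended by one pair. *)
Lemma card_le_total {T U : Type} (A : set T) (B : set U) : A #<= B \/ B #<= A.
Proof.
pose P (G : set (T * U)) :=
  G `<=` A `*` B /\ forall p q, G p -> G q -> p.1 = q.1 <-> p.2 = q.2.
have [F FP totF|G [[GAB Ginj] maxG]] := @Zorn_bigcup _ P.
  split=> [p [X FX Xp]|p q [X FX Xp] [Y FY Yq]]; first exact: (FP X FX).1.
  have [XY|YX] := totF _ _ FX FY.
    by apply: (FP Y FY).2 => //; exact: XY.
  by apply: (FP X FX).2 => //; exact: YX.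
have [domG|] := pselect (forall x, A x -> exists2 y, B y & G (x, y)).
  left; apply: (card_le_rel (fun x y => G (x, y))) => // x x' y _ _ Gx Gx'.
  exact/(Ginj _ _ Gx Gx').
have [rngG|] := pselect (forall y, B y -> exists2 x, A x & G (x, y)).
  right; apply: (card_le_rel (fun y x => G (x, y))) => // y y' x _ _ Gx Gx'.
  exact/(Ginj _ _ Gx Gx').
move=> /existsNP[b /not_implyP[Bb nb]] /existsNP[a /not_implyP[Aa na]].
have nGa y : ~ G (a, y).
  by move=> Gay; apply: na; exists y => //; exact: (GAB _ Gay).2.
have nGb x : ~ G (x, b).
  by move=> Gxb; apply: nb; exists x => //; exact: (GAB _ Gxb).1.
exfalso; apply: (maxG (G `|` [set (a, b)])).
  split=> [x Gx|]; first by left.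
  by move=> /(_ (a, b) (or_intror erefl))/nGa.
split=> [_ [/GAB//|->//]|[x y] [x' y'] [Gp|[-> ->]] [Gq|[-> ->]]] //=.
- exact: Ginj Gp Gq.
- by split=> xy; exfalso; move: Gp; rewrite xy; [exact: nGa|exact: nGb].
- by split=> xy; exfalso; move: Gq; rewrite -xy; [exact: nGa|exact: nGb].
Qed.

(** * Pairing functions on infinite types *)

Definition pairing {T : Type} (p : T -> T -> T) :=
  forall a b c d, p a b = p c d -> a = c /\ b = d.

Section Hessenberg.
Context {T : Type}.
Implicit Types G : set (T * T * T).

(** The set [A] from a graph [G] of a pairing [A * A -> A]; it is read off the
diagonal so that no separate record of [A] is carried through unions. *)
Definition pfield G : set T := [set x | exists z, G (x, x, z)].

(** Graphs of pairings [A * A -> A] with [A] infinite, together with the empty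
graph, which is the union of the empty chain. *)
Definition partial_pairing G :=
  [/\ forall p q z w, G (p, z) -> G (q, w) -> p = q <-> z = w,
      forall x y, pfield G x /\ pfield G y <-> exists z, G (x, y, z),
      forall p z, G (p, z) -> pfield G z &
      G = set0 \/ infinite_set (pfield G)].

Lemma partial_pairing_bigcup (F : set (set (T * T * T))) :
  F `<=` partial_pairing -> total_on F subset ->
  partial_pairing (\bigcup_(G in F) G).
Proof.
move=> FP totF.
have fieldU G : F G -> pfield G `<=` pfield (\bigcup_(G in F) G).
  by move=> FG x [z Gxz]; exists z, G.
have common G H : F G -> F H -> exists2 L, F L & G `<=` L /\ H `<=` L.
  by move=> FG FH; have [GH|HG] := totF _ _ FG FH;
    [exists H => //; split|exists G => //; split].
split.
- move=> p q z w [G FG Gpz] [H FH Hqw]; have [L FL [GL HL]] := common _ _ FG FH.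
  by have [L1 _ _ _] := FP _ FL; exact: L1 (GL _ Gpz) (HL _ Hqw).
- move=> x y; split=> [[[z [G FG Gxz]] [w [H FH Hyw]]]|[z [G FG Gxyz]]].
    have [L FL [GL HL]] := common _ _ FG FH.
    have [_ /(_ x y)[+ _] _ _] := FP _ FL; case.
      by split; [exists z; exact: GL|exists w; exact: HL].
    by move=> t Lt; exists t, L.
  have [_ /(_ x y)[_ dG] _ _] := FP _ FG.
  by have [|? ?] := dG; [exists z|split; exact: (fieldU _ FG)].
- move=> p z [G FG Gpz]; have [_ _ G3 _] := FP _ FG.
  by apply: (fieldU _ FG); exact: G3 Gpz.
- have [[G FG infG]|noinf] :=
      pselect (exists2 G, F G & infinite_set (pfield G)).
    by right; exact: sub_infinite_set (fieldU _ FG) infG.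
  left; apply/seteqP; split=> // p [G FG Gp].
  have [_ _ _ [G0|infG]] := FP _ FG; first by rewrite -G0.
  by exfalso; apply: noinf; exists G.
Qed.

Definition pairing_graph (A : set T) (f : T -> T -> T) : set (T * T * T) :=
  [set q | [/\ A q.1.1, A q.1.2 & f q.1.1 q.1.2 = q.2]].

Lemma partial_pairing_graph (A : set T) (f : T -> T -> T) :
  infinite_set A ->
  (forall x y, A x -> A y -> A (f x y)) ->
  (forall a b c d, A a -> A b -> A c -> A d ->
    f a b = f c d -> a = c /\ b = d) ->
  partial_pairing (pairing_graph A f).
Proof.
move=> infA stA injf; set G := pairing_graph A f.
have fG : pfield G = A.
  by apply/seteqP; split=> [x [z []]//|x Ax]; exists (f x x).
split.
- move=> [a b] [c d] _ _ [/= Aa Ab <-] [/= Ac Ad <-]; split=> [[-> ->]//|].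
  by move=> /injf[] // -> ->.
- rewrite fG => x y; split=> [[Ax Ay]|[z []//]].
  by exists (f x y).
- by move=> [x y] z [/= Ax Ay <-]; rewrite fG; exact: stA.
- by right; rewrite fG.
Qed.

(** Hessenberg's theorem.  Take a maximal pairing [f] on an infinite set [A].
If the complement of [A] is no larger than [A], then [T] injects into [A] and
[f] transports to [T].  Otherwise the complement contains a copy [J] of [A],
and [f] extends to the union of [A] and [J] by sending the new pairs into [J],
against maximality. *)
Theorem pairing_of_infinite : infinite_set [set: T] ->
  exists p : T -> T -> T, pairing p.
Proof.
move=> infT.
have [t0 _] := infinite_setN0 infT.
have /infiniteP/(card_le_inj t0)[i [_ /(_ _ _ I I) i_inj]] := infT.
have [G [PG maxG]] := Zorn_bigcup partial_pairing_bigcup.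
have infG : infinite_set (pfield G).
  case: (PG) => _ _ _ [] // G0.
  (* A countable set carries a pairing, so the maximal one is not empty. *)
  pose f x y := i (pickle (pinv setT i x, pinv setT i y)).
  have ipinv x : range i x -> i (pinv setT i x) = x.
    by move=> rx; apply: pinvK; rewrite inE.
  exfalso; apply: (maxG (pairing_graph (range i) f)).
    rewrite G0; split=> //.
    by move=> /(_ (i 0, i 0, f (i 0) (i 0))); apply; split=> //=; exists 0.
  apply: partial_pairing_graph.
  - apply/infiniteP; apply: (card_le_rel (fun n x => x = i n)).
      by move=> n _; exists (i n).
    by move=> m n _ _ _ -> /i_inj.
  - by move=> x y _ _; exists (pickle (pinv setT i x, pinv setT i y)).
  - move=> a b c d ra rb rc rd /i_inj/(pcan_inj pickleK)[ac bd].
    by rewrite -(ipinv a)// -(ipinv b)// ac bd !ipinv.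
have [G1 G2 G3 _] := PG.
set A := pfield G in infG G2 G3.
pose f x y :=
  if pselect (exists z, G (x, y, z)) is left ez then sval (cid ez) else t0.
have fP x y : A x -> A y -> G (x, y, f x y).
  move=> Ax Ay; rewrite /f.
  by case: pselect => [ez|/(_ ((G2 x y).1 (conj Ax Ay)))//]; case: cid.
have fA x y : A x -> A y -> A (f x y) by move=> Ax Ay; exact: G3 (fP x y Ax Ay).
have f_inj a b c d : A a -> A b -> A c -> A d ->
    f a b = f c d -> a = c /\ b = d.
  move=> Aa Ab Ac Ad fE.
  by have /(_ fE)[-> ->] := (G1 _ _ _ _ (fP a b Aa Ab) (fP c d Ac Ad)).2.
have /infiniteP/(card_le_inj t0)[n [nA /(_ _ _ I I) n_inj]] := infG.
have tag_inj (b c : bool) : n b = n c -> b = c by move/n_inj; case: b; case: c.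
(* The pairing absorbs into [A] a disjoint set [C] no larger than [A]: first
   components [n true] and [n false] tell the two parts apart. *)
have absorb C : C `<=` ~` A -> C #<= A -> exists e : T -> T,
    (forall x, (A `|` C) x -> A (e x)) /\
    (forall x y, (A `|` C) x -> (A `|` C) y -> e x = e y -> x = y).
  move=> CA /(card_le_inj t0)[j [jA j_inj]].
  pose r x := if x \in A then x else j x.
  have rA x : (A `|` C) x -> A (r x).
    rewrite /r; case: ifPn => [/set_mem//|/negP nAx [Ax|/jA//]].
    by case: nAx; exact: mem_set.
  exists (fun x => f (n (x \in A)) (r x)); split=> [x Ex|x y Ex Ey].
    by apply: fA; [exact: nA|exact: rA].
  move=> /f_inj[||||/tag_inj xyA]; [exact: nA|exact: rA|exact: nA|exact: rA|].
  rewrite /r -xyA; case: ifPn => // /negP nAx.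
  have nA_C z : (A `|` C) z -> ~ z \in A -> C z.
    by move=> [Az|//] nAz; case: nAz; exact: mem_set.
  by move=> exy; apply: j_inj => //; apply: nA_C => //; rewrite -xyA.
have [AC|CA] := card_le_total A (~` A).
  have [j [jC j_inj]] := card_le_inj t0 AC.
  pose J := j @` A.
  have JC : J `<=` ~` A by move=> _ [x Ax <-]; exact: jC.
  have [e [eA e_inj]] := absorb J JC (card_image_le j A).
  pose h x y := if (x \in A) && (y \in A) then f x y else j (f (e x) (e y)).
  have in_h x y : A x -> A y -> h x y = f x y.
    by move=> Ax Ay; rewrite /h !mem_set.
  exfalso; apply: (maxG (pairing_graph (A `|` J) h)).
    split=> [[[x y] z] Gxyz|].
      have [Ax Ay] := (G2 x y).2 (ex_intro _ z Gxyz).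
      split; [by left|by left|rewrite /= in_h//].
      by have /(_ erefl) := (G1 _ _ _ _ (fP x y Ax Ay) Gxyz).1.
    move=> sHG; have [a Aa] := infinite_setN0 infG.
    apply: (jC a Aa); rewrite -/A.
    have Ja : J (j a) by exists a.
    suff [] : A (j a) /\ A (j a) by [].
    by apply/G2; exists (h (j a) (j a)); apply: sHG; split=> //=; right.
  apply: partial_pairing_graph.
  - by apply: sub_infinite_set infG => x; left.
  - move=> x y Ex Ey; rewrite /h.
    case: ifPn => [/andP[/set_mem Ax /set_mem Ay]|_].
      by left; exact: fA.
    by right; exists (f (e x) (e y)) => //; apply: fA; exact: eA.
  - move=> a b c d Ea Eb Ec Ed; rewrite /h.
    have fe x y : (A `|` J) x -> (A `|` J) y -> A (f (e x) (e y)).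
      by move=> Ex Ey; apply: fA; exact: eA.
    case: ifPn => [/andP[/set_mem Aa /set_mem Ab]|_];
      case: ifPn => [/andP[/set_mem Ac /set_mem Ad]|_].
    + exact: f_inj.
    + by move=> fj; case: (jC _ (fe c d Ec Ed)); rewrite -fj; exact: fA.
    + by move=> fj; case: (jC _ (fe a b Ea Eb)); rewrite fj; exact: fA.
    + move=> /(j_inj _ _ (fe _ _ Ea Eb) (fe _ _ Ec Ed))/f_inj[]; do ?exact: eA.
      by move=> /e_inj -> // /e_inj ->.
have [e [eA e_inj]] := absorb _ (@subset_refl _ _) CA.
have eT x : (A `|` ~` A) x by rewrite setUv.
exists (fun x y => f (e x) (e y)) => a b c d.
by move=> /f_inj[]; do ?exact: eA; move=> /e_inj -> // /e_inj ->.
Qed.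
End Hessenberg.

(** A copy of [K] inside [E], seen as a [K]-by-[K] square, has a row that
misses [F], for otherwise [F] would contain a point of each of [K] many
disjoint rows. *)
Lemma card_leD_small {K T : Type} (p : K -> K -> K) (E F : set T) :
  T -> pairing p -> [set: K] #<= E -> ~ ([set: K] #<= F) ->
  [set: K] #<= E `\` F.
Proof.
move=> t0 p_inj /(card_le_inj t0)[g [gE /(_ _ _ I I) g_inj]] nF.
have [k kP] : exists k, forall l, ~ F (g (p k l)).
  apply: contrapT => /forallNP nk; apply: nF.
  apply: (card_le_rel (fun k y => exists l, y = g (p k l))).
    move=> k _; have /existsNP[l /contrapT Fl] := nk k.
    by exists (g (p k l)) => //; exists l.
  by move=> k k' _ _ _ [l ->] [l' /g_inj/p_inj[]].
apply: (card_le_rel (fun l y => y = g (p k l))).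
  by move=> l _; exists (g (p k l)) => //; split; [exact: gE|exact: kP].
by move=> l l' _ _ _ -> /g_inj/p_inj[].
Qed.

Lemma seq_code {K : Type} (p : K -> K -> K) (i : nat -> K) :
  pairing p -> injective i -> exists phi : seq K -> K, injective phi.
Proof.
move=> p_inj i_inj; pose enc := foldr p (i 0).
have enc_inj s s' : size s = size s' -> enc s = enc s' -> s = s'.
  elim: s s' => [|x s IHs] [|y s'] //= [ss'] /p_inj[-> /IHs->] //.
(* Without the length, [i 0] could be mistaken for the code of a longer
   sequence. *)
by exists (fun s => p (i (size s)) (enc s)) => s s' /p_inj[/i_inj/enc_inj].
Qed.

(** * Independent families *)

(** The signs are given by a function on all indices, so that no consistency
condition on repeated indices of [t] is needed. *)
Definition pattern {I : eqType} {T : Type} (P : I -> set T)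
    (t : seq I) (sg : I -> bool) : set T :=
  [set x | forall i, i \in t -> P i x <-> sg i].

Lemma finite_separation {K : Type} (t : seq (K -> bool)) : exists s : seq K,
  forall f g, f \in t -> g \in t -> map f s = map g s -> f = g.
Proof.
elim/Peq: K => K in t *.
have [x xP] : exists x : (K -> bool) -> (K -> bool) -> seq K,
    forall f g, map f (x f g) = map g (x f g) -> f = g.
  suff /choice[x xP] : forall fg : (K -> bool) * (K -> bool), exists u : seq K,
      map fg.1 u = map fg.2 u -> fg.1 = fg.2.
    by exists (fun f g => x (f, g)) => f g /(xP (f, g)).
  move=> [f g] /=; have [->|nfg] := pselect (f = g); first by exists [::].
  have /existsNP[k fgk] : ~ forall k, f k = g k by move=> /funext.
  by exists [:: k] => -[].
exists (flatten [seq x f g | f <- t, g <- t]) => f g ft gt /eq_in_map fg.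
apply/xP/eq_in_map => k kx; apply/fg/flattenP.
by exists (x f g) => //; apply/allpairsP; exists (f, g).
Qed.

(** Hausdorff's construction.  The ground set consists of the triples
[(k, s, W)] of a point, a finite sequence of points and a finite list of traces
on that sequence, coded in [K]; the set with index [f] collects the triples for
which the trace of [f] on [s] is listed in [W].  If [s] separates finitely many
functions, then [W] can prescribe at will which of them are to contain the
triple; the idle component [k] provides [|K|] solutions. *)
Lemma independent_family {K : Type} : infinite_set [set: K] ->
  exists B : (K -> bool) -> set K,
    forall t sg, [set: K] #<= pattern B t sg.
Proof.
move=> infK; have [k0 _] := infinite_setN0 infK.
have /infiniteP/(card_le_inj k0)[i [_ /(_ _ _ I I) i_inj]] := infK.
have [p p_inj] := pairing_of_infinite infK.
have [phi phi_inj] := seq_code p i p_inj i_inj.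
pose psi (k : K) (s : seq K) (W : seq (seq bool)) :=
  p k (p (phi s) (i (pickle W))).
exists (fun f => [set x | exists k s W, x = psi k s W /\ map f s \in W]).
move=> t sg.
have [s sP] := finite_separation t.
pose W := [seq map f s | f <- t & sg f].
have mapW f : f \in t -> (map f s \in W) = sg f.
  move=> ft; apply/mapP/idP => [[g + /sP fg]|sgf].
    by rewrite mem_filter => /andP[sgg gt]; rewrite fg.
  by exists f => //; rewrite mem_filter sgf.
apply: (card_le_rel (fun k x => x = psi k s W)).
  move=> k _; exists (psi k s W) => // f ft /=; rewrite -mapW//.
  split; last by exists k, s, W.
  move=> [k' [s' [W' [/p_inj[_ /p_inj[/phi_inj<-]]]]]].
  by move=> /i_inj/(pcan_inj pickleK)<-.
by move=> k k' _ _ _ -> /p_inj[].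
Qed.

(** A set and a point are coded in one subset of [K] by means of two disjoint
copies of [K] inside [K]. *)
Lemma surjection_on_pointed_sets {K : Type} : infinite_set [set: K] ->
  exists idx : (K -> bool) -> set K * K, forall A a, exists i, idx i = (A, a).
Proof.
move=> infK; have [k0 _] := infinite_setN0 infK.
have /infiniteP/(card_le_inj k0)[n [_ /(_ _ _ I I) n_inj]] := infK.
have [p p_inj] := pairing_of_infinite infK.
suff [e eK] : exists e : set K * K -> (K -> bool), injective e.
  have [f fP] : exists f : (K -> bool) -> set K * K, forall q, f (e q) = q.
    suff /choice[f fP] : forall g, exists q, forall q', g = e q' -> q = q'.
      by exists f => q; exact: fP.
    move=> g; have [[q ->]|nq] := pselect (exists q, g = e q).
      by exists q => q' /eK.
    by exists (setT, k0) => q gq; case: nq; exists q.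
  by exists f => A a; exists (e (A, a)).
pose code (A : set K) a k :=
  `[< (exists2 x, k = p (n 0) x & A x) \/ k = p (n 1) a >].
exists (fun q => code q.1 q.2).
move=> [A a] [A' a'] E; congr (_, _).
  have sub A1 a1 A2 a2 : code A1 a1 =1 code A2 a2 -> A1 `<=` A2.
    move=> EA x Ax; have /esym/asboolP := EA (p (n 0) x).
    rewrite [code _ _ _]asboolT; last by left; exists x.
    by move=> [[y /p_inj[_ ->]//]|/p_inj[/n_inj]].
  by apply/seteqP; split; [apply: (sub _ a _ a')|apply: (sub _ a' _ a)] => k;
    rewrite (congr1 (@^~ k) E).
have /esym/asboolP := congr1 (@^~ (p (n 1) a)) E.
rewrite [code _ _ _]asboolT; last by right.
by move=> [[y /p_inj[/n_inj]]|/p_inj[]].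
Qed.

(** * The submaximal family *)

Definition everywhere_large {I : eqType} {K : Type} (B : I -> set K)
    (A : set K) :=
  forall t sg, [set: K] #<= A `&` pattern B t sg.

(** A maximal family closed under intersection stays so after adjoining [D] and
its intersections with members, as long as these are all large; so maximality
becomes a criterion for membership. *)
Lemma maximal_large_family {I : eqType} {K : Type} (B : I -> set K) :
  (forall t sg, [set: K] #<= pattern B t sg) ->
  exists DD : set (set K),
  [/\ DD `<=` everywhere_large B,
      DD setT,
      forall A A', DD A -> DD A' -> DD (A `&` A') &
      forall D, (forall A, DD A -> everywhere_large B (A `&` D)) -> DD D].
Proof.
move=> B_ind.
pose Q (DD : set (set K)) := DD `<=` everywhere_large B /\
  forall A A', DD A -> DD A' -> DD (A `&` A').
have [F FQ totF|DD [[DDl DDI] maxDD]] := @Zorn_bigcup _ Q.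
  split=> [A [X FX XA]|A A' [X FX XA] [Y FY YA']]; first exact: (FQ X FX).1.
  have [XY|YX] := totF _ _ FX FY.
    by exists Y => //; apply: (FQ Y FY).2 => //; exact: XY.
  by exists X => //; apply: (FQ X FX).2 => //; exact: YX.
have maximal (F : set (set K)) : DD `<=` F -> Q F -> F `<=` DD.
  move=> DDF QF; apply: contrapT => FDD; exact: (maxDD F).
have DDT : DD setT.
  apply: (maximal (DD `|` [set setT])); [by move=> A; left| |by right].
  split=> [A [/DDl//|->]|A A' [DA|->] [DA'|->]].
  - by move=> t sg; rewrite setTI.
  - by left; exact: DDI.
  - by left; rewrite setIT.
  - by left; rewrite setTI.
  - by right; rewrite setIT.
exists DD; split=> // D Dl.
apply: (maximal (DD `|` [set A `&` D | A in DD])); first by move=> A; left.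
  split=> [A [/DDl//|[A' DA' <-]]|A A' [DA|[X DX <-]] [DA'|[X' DX' <-]]].
  - exact: Dl.
  - by left; exact: DDI.
  - by right; exists (A `&` X'); [exact: DDI|rewrite setIA].
  - by right; exists (X `&` A'); [exact: DDI|rewrite setIAC].
  - by right; exists (X `&` X'); [exact: DDI|rewrite setIACA setIid].
by right; exists setT => //; rewrite setTI.
Qed.

(** The combinatorial content of the theorem: patterns are the traces of basic
open sets, so the second clause makes every dense set open. *)
Theorem submaximal_family {K : Type} : infinite_set [set: K] ->
  exists P : (K -> bool) -> set K,
    (forall t sg, [set: K] #<= pattern P t sg) /\
    (forall D, (forall t sg, D `&` pattern P t sg !=set0) ->
      forall k, D k -> exists i, P i k /\ P i `<=` D).
Proof.
move=> infK.
have [p p_inj] := pairing_of_infinite infK.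
have [B B_ind] := independent_family infK.
have [idx idxP] := surjection_on_pointed_sets infK.
have [DD [DDl DDT DDI DDmax]] := maximal_large_family B B_ind.
have smallC E : ~ ([set: K] #<= E) -> DD (~` E).
  move=> nE; apply: DDmax => A /DDl Al t sg.
  have [k0 _] := infinite_setN0 infK.
  by rewrite setIAC -setDE; apply: (card_leD_small p).
have small1 k : ~ ([set: K] #<= [set k]).
  by move=> /card_le_finite/(_ (finite_set1 k)).
pose A i := if pselect (DD (idx i).1) then (idx i).1 else setT.
have DDA i : DD (A i) by rewrite /A; case: pselect.
pose P i := (B i `&` A i) `|` [set (idx i).2].
(* Finitely many of the perturbations are invisible on a member of [DD]. *)
have P_B (t : seq (K -> bool)) :
    exists2 C, DD C & forall i x, i \in t -> C x -> P i x <-> B i x.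
  elim: t => [|j t [C DC CP]]; first by exists setT.
  exists (C `&` (A j `&` ~` [set (idx j).2])).
    by apply: (DDI) => //; apply: DDI => //; apply: smallC; exact: small1.
  move=> i x; rewrite inE => /orP[/eqP->|it] [Cx [Ajx nx]]; last exact: CP.
  by split=> [[[]//|/nx]|Bx] //; left.
exists P; split=> [t sg|D Dd k Dk].
  have [C DC CP] := P_B t.
  apply: card_le_trans (DDl C DC t sg) _.
  apply: subset_card_le => x [Cx Bx] i it.
  by rewrite (CP i x it Cx); exact: Bx.
suff DD_D : DD D.
  have [i iE] := idxP D k; exists i; rewrite /P /A iE /=.
  case: pselect => //= _.
  by split=> [|x [[]//|->//]]; right.
apply: DDmax => A0 DA0 t sg; apply: contrapT => nE.
have [C DC CP] := P_B t.
(* By [nE] the set removed has size less than [|K|], so [A1] is in [DD].  Within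
   [C] the patterns of [P] and [B] over [t] agree, so no point of [A1] in the
   pattern of [P] lies in [D]. *)
pose A1 := A0 `&` C `&` ~` (A0 `&` D `&` pattern B t sg).
have DA1 : DD A1 by apply: (DDI); [exact: DDI|exact: smallC].
have [a [A1a Ba]] : A1 `&` pattern B t sg !=set0.
  by apply: infinite_setN0 => fin; apply/infK/(card_le_finite _ fin)/DDl.
have [j jE] := idxP A1 a.
have PjE : P j = (B j `&` A1) `|` [set a].
  by rewrite /P /A jE /=; case: pselect.
(* The set [P j] is used as a neighbourhood of [a] inside [A1]; taking the signs
   of [a] itself keeps the pattern consistent when [j] already occurs in [t]. *)
pose sg' i := `[< P i a >].
have [x [Dx Px]] := Dd (j :: t) sg'.
have A1x : A1 x.
  have : P j x.
    by apply/(Px j); [rewrite mem_head|apply/asboolP; rewrite PjE; right].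
  by rewrite PjE => -[[]//|->].
have [[A0x Cx]] := A1x; apply; split=> // i it.
have [[_ Ca] _] := A1a.
rewrite -(CP i x it Cx) Px ?inE ?it ?orbT//.
by rewrite -(Ba i it) -(CP i a it Ca).
Qed.

(** * Transfer to the Cantor cube *)

(** Convergence in the cube is coordinatewise, hence the filter of the finite
agreement sets around [x] converges to [x]. *)
Lemma cantor_cube_open_pattern (I : eqType) (U : set (cantor_cube I))
    (x : cantor_cube I) :
  open U -> U x ->
  exists t : seq I,
    forall y : cantor_cube I, (forall i, i \in t -> y i = x i) -> U y.
Proof.
move=> oU Ux.
pose F := filter_from [set: seq I]
  (fun t => [set y : cantor_cube I | forall i, i \in t -> y i = x i]).
have FF : Filter F.
  apply: filter_from_filter; first by exists [::].
  move=> s t _ _; exists (s ++ t) => // y yst.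
  by split=> i it; apply: yst; rewrite mem_cat it ?orbT.
suff Fx : F --> x.
  by have [t _ tU] := Fx U (open_nbhs_nbhs (conj oU Ux)); exists t.
apply/cvg_sup => i V [_ [[W _ <-] Wx] WV].
exists [:: i] => // y /(_ i (mem_head _ _)) yx.
by apply: WV; rewrite /= yx.
Qed.

Lemma cantor_cube_coordinate_open (I : eqType) (i : I) (b : bool) :
  open [set x : cantor_cube I | x i = b].
Proof.
have /continuousP/(_ [set b]) :
    continuous (@proj I (fun=> bool) i : cantor_cube I -> bool).
  exact: proj_continuous.
by apply; exact: discrete_open.
Qed.

Lemma cantor_cube_pattern_open (I : eqType) (t : seq I) (sg : I -> bool) :
  open [set x : cantor_cube I | forall i, i \in t -> x i = sg i].
Proof.
elim: t => [|j t IHt].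
  by rewrite (_ : mkset _ = setT); [exact: openT|apply/seteqP].
rewrite (_ : mkset _ = [set x : cantor_cube I | x j = sg j] `&`
    [set x | forall i, i \in t -> x i = sg i]).
  by apply: openI => //; exact: cantor_cube_coordinate_open.
apply/seteqP; split=> x /=.
  by move=> xt; split=> [|i it]; apply: xt; rewrite inE ?eqxx ?it ?orbT.
by move=> [xj xt] i; rewrite inE => /orP[/eqP->//|/xt].
Qed.

Theorem theorem4p1 (K : Type) :
  infinite_set [set: K] ->
  exists X : set (cantor_cube (K -> bool)),
    [/\ dense X,
        submaximal (set_type X),
        X #= [set: K] &
        is_dispersion_character (set_type X) K].
Proof.
move=> infK; have [P [P_large P_sub]] := submaximal_family infK.
pose e (k : K) : cantor_cube (K -> bool) := fun i => `[< P i k >].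
have e_pattern k t sg : pattern P t sg k <-> forall i, i \in t -> e k i = sg i.
  split=> [Pk i it|ek i it].
    by apply/asboolP/idP => /(Pk i it).
  by rewrite -ek//; split=> /asboolP.
have e_inj k l : e k = e l -> k = l.
  move=> ekl; apply: contrapT => nkl.
  have [|i [Pik Pl]] := P_sub [set x | x <> l] _ k nkl.
    move=> t sg; rewrite setIC; apply: infinite_setN0.
    apply: (@infinite_setD _ _ [set l]); last exact: finite_set1.
    by move=> fin; apply/infK/(card_le_finite _ fin).
  have /asboolP/Pl : e l i by rewrite -ekl; exact/asboolP.
  by apply.
pose X := range e.
pose emb k : X := SigSub (mem_set (imageT e k)).
have X_emb (x : X) : exists k, x = emb k.
  case: x => x Xx; have [k _ ek] := set_mem Xx; exists k.
  exact: val_inj.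
have pattern_neq0 t sg : pattern P t sg !=set0.
  by apply: infinite_setN0 => fin; apply/infK/(card_le_finite _ fin).
have XK : X #= [set: K] by apply: inj_card_eq => k l _ _; exact: e_inj.
exists X; split=> //.
- move=> U [u Uu] oU; have [t tU] := cantor_cube_open_pattern _ U u oU Uu.
  have [k /e_pattern/tU Uk] := pattern_neq0 t u.
  by exists (e k); split=> //; exists k.
- move=> D Dd.
  rewrite openE => x Dx; have [k xE] := X_emb x.
  have [t sg||i [Pik PiD]] := P_sub [set k | D (emb k)] _ k.
  + pose O := [set y : X | forall i, i \in t -> val y i = sg i].
    have O0 : O !=set0.
      by have [l /e_pattern lt] := pattern_neq0 t sg; exists (emb l).
    have oO : open O by eexists; [exact: (cantor_cube_pattern_open _ t sg)|].
    have [y [yt Dy]] := Dd O O0 oO.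
    have [l yE] := X_emb y; exists l; rewrite yE in Dy yt.
    by split=> //; apply/e_pattern.
  + by rewrite /= -xE.
  + rewrite /interior nbhsE; exists [set y : X | val y i = true].
      split; last by rewrite xE; exact: asboolT.
      by eexists; [exact: (cantor_cube_coordinate_open _ i true)|].
    move=> y; have [l ->] := X_emb y => /asboolP; exact: PiD.
- split.
    exists setT; split; [exact: openT| |].
      by have [k _] := infinite_setN0 infK; exists (emb k).
    by apply: card_eq_trans XK; exact: card_setT.
  move=> U [V oV <-] [x Vx].
  have [t tV] := cantor_cube_open_pattern _ V _ oV Vx.
  apply: card_le_trans (P_large t (val x)) _.
  apply: (card_le_rel (fun k y => y = emb k)).
    by move=> k /e_pattern kt; exists (emb k) => //; exact: tV.
  by move=> k l _ _ _ -> /(congr1 val)/e_inj.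
Qed.
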